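(* Let $A\in\mathbb{R}^{n\times n}$ be the adjacency matrix of a connected, undirected, unweighted network on $n$ nodes with at least one edge (so $A$ is symmetric, $a_{ii}=0$, and $a_{ij}=a_{ji}\in\{0,1\}$). Let $\mathbf{1}\in\mathbb{R}^n$ be the all-ones vector, $\mathbf{d}=A\mathbf{1}$ the degree vector, and let $\mathbf{x}$ be the Perron--Frobenius eigenvector of $A$ (i.e. $A\mathbf{x}=\lambda_1\mathbf{x}$ with $\lambda_1$ the spectral radius of $A$ and all entries of $\mathbf{x}$ positive). Then \[ \frac{\mathbf{d}^T\mathbf{x}}{\|\mathbf{d}\|_1}-\frac{\|\mathbf{x}\|_1}{n}\ \ge\ 0, \] with equality if and only if the network is regular (all nodes have the same degree).
   Context: $\|\mathbf{v}\|_1=\sum_i|v_i|$. The eigenvector $\mathbf{x}$ is the eigenvector centrality of the network. *)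

(* Defs.v *)
From mathcomp Require Import all_boot all_order all_algebra.
From mathcomp Require Import complex.
From mathcomp Require Import boolp classical_sets reals.

Set Implicit Arguments.
Unset Strict Implicit.
Unset Printing Implicit Defensive.

Import Order.TTheory GRing.Theory Num.Theory.

Local Open Scope ring_scope.
Local Open Scope complex_scope.
Local Open Scope classical_set_scope.

(* An unweighted network on n nodes is a relation e on 'I_n: e i j means that
   i and j are joined by an edge. *)

Definition undirected_network (n : nat) (e : rel 'I_n) : Prop :=
  symmetric e /\ irreflexive e.

Definition connected_network (n : nat) (e : rel 'I_n) : Prop :=
  forall i j : 'I_n, connect e i j.

Definition degree (n : nat) (e : rel 'I_n) (i : 'I_n) : nat :=
  #|[set j : 'I_n | e i j]%SET|.

Definition regular_network (n : nat) (e : rel 'I_n) : Prop :=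
  forall i j : 'I_n, degree e i = degree e j.

Definition adjacency (R : realType) (n : nat) (e : rel 'I_n) : 'M[R]_n :=
  \matrix_(i, j) (e i j)%:R.

Definition ones (R : realType) (n : nat) : 'cV[R]_n := const_mx 1.

Definition degree_vector (R : realType) (n : nat) (e : rel 'I_n) : 'cV[R]_n :=
  adjacency R e *m ones R n.

Definition norm1 (R : realType) (n : nat) (v : 'cV[R]_n) : R :=
  \sum_i `|v i 0|.

(* Largest modulus of a complex eigenvalue. The spectrum is finite, and
   nonempty for n > 0, so the supremum is then a maximum. *)
Definition spectral_radius (R : realType) (n : nat) (A : 'M[R]_n) : R :=
  sup [set ComplexField.Normc.normc z | z in
        [set z : R[i] | eigenvalue (map_mx (fun a : R => a%:C) A) z]].

Definition Perron_eigenvector (R : realType) (n : nat) (A : 'M[R]_n)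
    (x : 'cV[R]_n) : Prop :=
  A *m x = spectral_radius A *: x /\ (forall i, 0 < x i 0).

(* Main.v *)
(** Since [A] is symmetric, [d^T x = 1^T A x = l * |x|_1], so the sign of the gap
is that of [n * l - |d|_1].  Dividing row [i] of [A x = l x] by [x_i], summing
over [i] and symmetrizing gives
[2 (n l - |d|_1) = \sum_(i, j) a_ij (x_i - x_j)^2 / (x_i x_j)].
The right-hand side is nonnegative, and it vanishes iff [x] is constant along
every edge, hence, by connectedness, everywhere; then [d = l 1]. *)
Require Import Defs.
From mathcomp Require Import all_boot all_order all_algebra.
From mathcomp Require Import reals ring.

Import Order.TTheory GRing.Theory Num.Theory.

Local Open Scope ring_scope.

Lemma sum_eigen_ratio {F : fieldType} {n : nat} {A : 'M[F]_n} {x : 'cV[F]_n}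
    {l : F} :
  A *m x = l *: x -> (forall i, x i 0 != 0) ->
  \sum_i \sum_j A i j * (x j 0 / x i 0) = n%:R * l.
Proof.
move=> Axl x_neq0; rewrite mulr_natl -[n in RHS]card_ord -sumr_const.
apply: eq_bigr => i _.
have /matrixP/(_ i 0) := Axl; rewrite !mxE => Axli.
rewrite -[RHS](mulfK (x_neq0 i)) -Axli mulr_suml.
by apply: eq_bigr => j _; rewrite mulrA.
Qed.

(** Since [(a - b)^2 / (a b) = a / b + b / a - 2], the left side splits into two ratio sums, each
    equal to [n l] (the second by symmetry of [A]), minus twice the sum of the entries. *)
Lemma symmetric_eigen_excess {F : fieldType} {n : nat} {A : 'M[F]_n}
    {x : 'cV[F]_n} {l : F} :
  A^T = A -> A *m x = l *: x -> (forall i, x i 0 != 0) ->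
  \sum_i \sum_j A i j * ((x i 0 - x j 0) ^+ 2 / (x i 0 * x j 0)) =
  (n%:R * l - \sum_i \sum_j A i j) *+ 2.
Proof.
move=> Asym Axl x_neq0.
have ratio := sum_eigen_ratio Axl x_neq0.
have ratioT : \sum_i \sum_j A i j * (x i 0 / x j 0) = n%:R * l.
  rewrite -ratio exchange_big; apply: eq_bigr => i _; apply: eq_bigr => j _.
  by rewrite -[in LHS]Asym mxE.
(* One copy of [n l] becomes [ratio], the other its transpose, so the identity can be checked term
   by term. *)
rewrite mulrnBl mulr2n -{1}ratio -ratioT -big_split -sumrMnl -sumrB.
apply: eq_bigr => i _; rewrite -big_split -sumrMnl -sumrB.
apply: eq_bigr => j _ /=.
by field; rewrite !x_neq0.
Qed.

(** Equality propagates along a path joining [i] to [j]. *)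
Lemma connected_edge_const {n : nat} {e : rel 'I_n} {T : eqType}
    {f : 'I_n -> T} :
  connected_network e -> (forall i j, e i j -> f i = f j) ->
  forall i j, f i = f j.
Proof.
move=> e_conn f_edge i j; have /connectP[p ep ->] := e_conn i j.
elim: p i ep => //= k p IHp i /andP[eik ep].
by rewrite (f_edge _ _ eik); apply: IHp.
Qed.

Section Adjacency.

Context {R : realType} {n : nat} {e : rel 'I_n}.

Lemma degree_vectorE i : degree_vector R e i 0 = (degree e i)%:R.
Proof.
rewrite /degree_vector /degree mxE -sum1_card natr_sum [RHS]big_mkcond.
by apply: eq_bigr => j _; rewrite !mxE mulr1 inE; case: (e i j).
Qed.

Lemma adjacency_row_sum i : \sum_j adjacency R e i j = (degree e i)%:R.
Proof.
rewrite -degree_vectorE mxE; apply: eq_bigr => j _.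
by rewrite [ones R n j 0]mxE mulr1.
Qed.

Lemma trmx_adjacency : symmetric e -> (adjacency R e)^T = adjacency R e.
Proof. by move=> e_sym; apply/matrixP => i j; rewrite !mxE e_sym. Qed.

Lemma norm1_degree_vector :
  norm1 (degree_vector R e) = \sum_i (degree e i)%:R.
Proof. by apply: eq_bigr => i _; rewrite degree_vectorE normr_nat. Qed.

(** Ensures that the gap divides by a nonzero norm, as division by zero would return 0. *)
Lemma norm1_degree_vector_gt0 :
  (exists i j, e i j) -> 0 < norm1 (degree_vector R e).
Proof.
case=> i [j eij]; rewrite norm1_degree_vector -natr_sum ltr0n (bigD1 i) //=.
rewrite addn_gt0 card_gt0.
by apply/orP; left; apply/set0Pn; exists j; rewrite inE.
Qed.

Lemma degree_vector_dot {x : 'cV[R]_n} :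
  ((degree_vector R e)^T *m x) 0 0 = \sum_i (degree e i)%:R * x i 0.
Proof. by rewrite mxE; apply: eq_bigr => i _; rewrite mxE degree_vectorE. Qed.

Lemma degree_vector_dot_eigen {x : 'cV[R]_n} {l : R} :
  symmetric e -> adjacency R e *m x = l *: x ->
  ((degree_vector R e)^T *m x) 0 0 = l * \sum_i x i 0.
Proof.
move=> e_sym Axl; rewrite trmx_mul trmx_adjacency // -mulmxA Axl.
rewrite mxE mulr_sumr; apply: eq_bigr => i _.
by rewrite !mxE mul1r.
Qed.

Lemma norm1_pos {x : 'cV[R]_n} :
  (forall i, 0 < x i 0) -> norm1 x = \sum_i x i 0.
Proof. by move=> x_gt0; apply: eq_bigr => i _; rewrite gtr0_norm. Qed.

Lemma edge_term_ge0 {x : 'cV[R]_n} : (forall i, 0 < x i 0) -> forall i j,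
  0 <= adjacency R e i j * ((x i 0 - x j 0) ^+ 2 / (x i 0 * x j 0)).
Proof.
move=> x_gt0 i j.
by rewrite mxE mulr_ge0 ?ler0n // divr_ge0 ?sqr_ge0 // mulr_ge0 ?ltW.
Qed.

(** The average degree is at most [l]: the excess is half a sum of nonnegative edge terms. *)
Lemma norm1_degree_vector_le {x : 'cV[R]_n} {l : R} :
  symmetric e -> adjacency R e *m x = l *: x -> (forall i, 0 < x i 0) ->
  norm1 (degree_vector R e) <= n%:R * l.
Proof.
move=> e_sym Axl x_gt0.
have x_neq0 i : x i 0 != 0 by rewrite gt_eqF.
have := symmetric_eigen_excess (trmx_adjacency e_sym) Axl x_neq0.
under [in RHS]eq_bigr => i _ do rewrite adjacency_row_sum.
rewrite -norm1_degree_vector => excess.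
rewrite -subr_ge0 -(pmulrn_lge0 _ (isT : (0 < 2)%N)) -excess.
by do 2![apply: sumr_ge0 => ? _]; apply: edge_term_ge0.
Qed.

Lemma norm1_degree_vector_eq {x : 'cV[R]_n} {l : R} :
  symmetric e -> connected_network e ->
  adjacency R e *m x = l *: x -> (forall i, 0 < x i 0) ->
  n%:R * l = norm1 (degree_vector R e) -> regular_network e.
Proof.
move=> e_sym e_conn Axl x_gt0 nl_eq.
have x_neq0 i : x i 0 != 0 by rewrite gt_eqF.
have := symmetric_eigen_excess (trmx_adjacency e_sym) Axl x_neq0.
under [in RHS]eq_bigr => i _ do rewrite adjacency_row_sum.
rewrite -norm1_degree_vector nl_eq subrr mul0rn => sum0.
have x_const : forall i j, x i 0 = x j 0.
  apply: (connected_edge_const (f := fun i => x i 0) e_conn) => i j eij.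
  (* A zero sum of nonnegative terms has only zero terms: first the rows, then the entries of row
     [i]. *)
  have rows0 := psumr_eq0P (fun i _ => sumr_ge0 _ (fun j _ =>
    edge_term_ge0 x_gt0 i j)) sum0.
  have := psumr_eq0P (fun j _ => edge_term_ge0 x_gt0 i j) (rows0 i isT).
  move=> /(_ j isT)/eqP; rewrite mxE eij mul1r !mulf_eq0 invr_eq0 !mulf_eq0.
  by rewrite !(negPf (x_neq0 _)) !orbF orbb subr_eq0 => /eqP.
(* With [x] constant, row [i] of the eigenvector equation says that the degree times [x_i] is
   [l x_i]. *)
have deg_l i : (degree e i)%:R = l.
  have /matrixP/(_ i 0) := Axl; rewrite mxE [RHS]mxE.
  under eq_bigr => j _ do rewrite (x_const j i).
  by rewrite -mulr_suml adjacency_row_sum => /(mulIf (x_neq0 i)).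
by move=> i j; apply/eqP; rewrite -(eqr_nat R) !deg_l.
Qed.

End Adjacency.

Theorem theorem1 (R : realType) (n : nat) (e : rel 'I_n) (x : 'cV[R]_n)
    (e_undirected : undirected_network e)
    (e_connected : connected_network e)
    (e_edge : exists i j : 'I_n, e i j)
    (x_Perron : Perron_eigenvector (adjacency R e) x) :
  let d := degree_vector R e in
  let gap := (d^T *m x) 0 0 / norm1 d - norm1 x / n%:R in
  gap >= 0 /\ (gap = 0 <-> regular_network e).
Proof.
move=> d gap; rewrite {}/gap {}/d.
have [e_sym _] := e_undirected; have [Axl x_gt0] := x_Perron.
set l := spectral_radius _ in Axl; set D := norm1 (degree_vector R e).
(* The endpoint [i0] shows that [n] is positive, and later serves as the reference node for the
   common degree. *)
have [i0 _] := e_edge.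
have n_gt0 : 0 < n%:R :> R by rewrite ltr0n (leq_trans _ (ltn_ord i0)).
have D_gt0 : 0 < D by apply: norm1_degree_vector_gt0.
have S_gt0 : 0 < norm1 x.
  rewrite norm1_pos // (bigD1 i0) //= ltr_pwDl //.
  by apply: sumr_ge0 => i _; apply: ltW.
(* A positive factor is split off, so the gap has the sign and the zeros of [n l - D]. *)
have gapE : ((degree_vector R e)^T *m x) 0 0 / D - norm1 x / n%:R =
    norm1 x / (D * n%:R) * (n%:R * l - D).
  rewrite (degree_vector_dot_eigen e_sym Axl) -norm1_pos //.
  by field; rewrite !gt_eqF.
have c_gt0 : 0 < norm1 x / (D * n%:R) by rewrite divr_gt0 // mulr_gt0.
split.
  by rewrite gapE pmulr_rge0 // subr_ge0 (norm1_degree_vector_le e_sym Axl).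
split=> [/eqP | e_reg].
  rewrite gapE mulf_eq0 gt_eqF //= subr_eq0 => /eqP nl_eq.
  exact: norm1_degree_vector_eq Axl x_gt0 nl_eq.
(* For common degree [k], both terms of the gap are computed directly; [k] cancels, being nonzero
   because [D] is positive. *)
have DE : D = n%:R * (degree e i0)%:R.
  rewrite /D norm1_degree_vector (eq_bigr (fun=> (degree e i0)%:R)).
    by rewrite sumr_const card_ord mulr_natl.
  by move=> i _; rewrite (e_reg i i0).
have k_neq0 : (degree e i0)%:R != 0 :> R.
  by move: D_gt0; rewrite DE pmulr_rgt0 // => /lt0r_neq0.
rewrite degree_vector_dot DE norm1_pos //.
under eq_bigr => i _ do rewrite (e_reg i i0).
by rewrite -mulr_sumr; field; rewrite k_neq0 gt_eqF.
Qed.
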